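(* Let $\aleph$ be an infinite cardinal and let $\mathcal{G}$ be a decomposition of the complete graph $K_\aleph$. Suppose there is a cardinal $\aleph'<\aleph$ such that (R1) each graph in $\mathcal{G}$ is $\aleph'$-bounded, and (R2) $|\mathcal{G}(x)\cap\mathcal{G}(y)|\le\aleph'$ for every two distinct vertices $x,y$ of $K_\aleph$. Then $\mathcal{G}$ is resolvable.
   Context: A decomposition of a graph $\Lambda$ is a family of subgraphs of $\Lambda$ whose edge sets partition $E(\Lambda)$. A graph is $\aleph'$-bounded if its order is at most $\aleph'$. For a vertex $v$, $\mathcal{G}(v)=\{\Gamma\in\mathcal{G}: v\in V(\Gamma)\}$. A decomposition $\mathcal{G}$ of $K_\aleph$ is resolvable if $\mathcal{G}$ can be partitioned into resolution classes, where a resolution class is a subfamily of $\mathcal{G}$ consisting of pairwise vertex-disjoint graphs whose vertex sets together cover $V(K_\aleph)$ (so that their union is a factor, i.e. spanning subgraph, of $K_\aleph$). *)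

(* Defs.v *)
From mathcomp Require Import all_boot.
From mathcomp Require Export boolp classical_sets functions cardinality.

Set Implicit Arguments.
Unset Strict Implicit.
Unset Printing Implicit Defensive.

Local Open Scope classical_set_scope.
Local Open Scope card_scope.

Definition pairs (T : Type) (V : set T) : set (set T) :=
  [set e | exists x y : T, [/\ V x, V y, x <> y & e = [set x; y]]].

(* Simple graphs on subsets of [T]; isolated vertices are allowed. *)
Record graph (T : Type) := Graph {
  vertices : set T;
  edges : set (set T);
  edges_pairs : edges `<=` pairs vertices
}.

Definition subgraph (T : Type) (H L : graph T) : Prop :=
  vertices H `<=` vertices L /\ edges H `<=` edges L.

(* The order of this graph is the cardinality of the type [T]. *)
Definition complete_graph (T : Type) : graph T :=
  @Graph T [set: T] (pairs [set: T]) (@subset_refl _ _).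

Definition card_lt (T U : Type) (A : set T) (B : set U) : Prop :=
  (A #<= B) /\ ~ (B #<= A).

(* The blocks of a [partition] are nonempty, so every member of a decomposition
   has an edge and distinct members have disjoint edge sets; hence no member can
   be repeated and a family is the same as a set of subgraphs. *)
Definition decomposition (T : Type) (L : graph T) (G : set (graph T)) : Prop :=
  (forall H, G H -> subgraph H L) /\ partition G (@edges T) (edges L).

Definition bounded_by (T U : Type) (A : set U) (H : graph T) : Prop :=
  vertices H #<= A.

Definition graphs_at (T : Type) (G : set (graph T)) (v : T) : set (graph T) :=
  [set H | G H /\ vertices H v].

Definition resolution_class (T : Type) (L : graph T) (G C : set (graph T)) :
    Prop :=
  [/\ C `<=` G, trivIset C (@vertices T) &
      cover C (@vertices T) = vertices L].

Definition resolvable (T : Type) (L : graph T) (G : set (graph T)) : Prop :=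
  exists P : set (set (graph T)),
    partition P id G /\ (forall C, P C -> resolution_class L G C).

(* Main.v *)
Require Import Defs.
From mathcomp Require Import all_boot.
From mathcomp Require Import boolp classical_sets functions cardinality.
From mathcomp Require Import wochoice.

Local Open Scope classical_set_scope.
Local Open Scope card_scope.

(* Assign graphs to classes indexed by [T] by transfinite recursion along a well
   order of [T] whose proper initial segments are smaller than [T]. The steps
   run through the [|T|^2 = |T|] requirements "class [i] covers the vertex [v]"
   and "the graph containing the edge [xy] belongs to some class". At each step
   fewer than [|T|] graphs have been assigned, so they cover fewer than [|T|]
   vertices and, by (R2), fewer than [|T|] graphs at [v] meet one of them away
   from [v]. By (R1) there are [|T|] graphs at [v], so a new one can be added to a
   class that misses [v]; and a graph not yet assigned can go to an unused
   class. *)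

(** * Comparison of cardinals by injections *)

Lemma card_le_inj {T U : Type} (A : set T) (B : set U) (f : T -> U) :
  (forall x, A x -> B (f x)) ->
  (forall x y, A x -> A y -> f x = f y -> x = y) -> A #<= B.
Proof.
move=> fAB finj.
have : f @` A #= A.
  by apply: inj_card_eq => x y /set_mem Ax /set_mem Ay; exact: finj.
rewrite card_eq_le => /andP[_ AfA]; apply: card_le_trans AfA _.
by apply: subset_card_le => _ [x Ax <-]; exact: fAB.
Qed.

Lemma card_le_ex_inj {T U : Type} (u : U) (A : set T) (B : set U) :
  A #<= B -> exists f : T -> U, (forall x, A x -> B (f x)) /\
    (forall x y, A x -> A y -> f x = f y -> x = y).
Proof.
move=> /card_leP[g].
(* [u] is only the default value outside [A]. *)
pose f x := if pselect (A x) is left Ax then val (g (SigSub (mem_set Ax)))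
  else u.
exists f; split=> [x Ax|x y Ax Ay].
  by rewrite /f; case: pselect => // Ax'; exact/set_mem/valP.
rewrite /f; case: pselect => // Ax'; case: pselect => // Ay' /val_inj.
by move=> /(@inj _ _ _ g)-/(_ (mem_set I) (mem_set I)) [].
Qed.

Lemma total_bigcup2 {T : Type} (F : set (set T)) : total_on F subset ->
  forall p q, (\bigcup_(X in F) X) p -> (\bigcup_(X in F) X) q ->
  exists2 X, F X & X p /\ X q.
Proof.
move=> Ftot p q [X FX Xp] [Y FY Yq]; have [XY|YX] := Ftot _ _ FX FY.
  by exists Y => //; split => //; exact: XY.
by exists X => //; split => //; exact: YX.
Qed.

(** Zorn's lemma gives a maximal set [X] of pairs matching part of [A] injectively with part of [B].
    If some [a] in [A] and some [b] in [B] were both unmatched, [(a, b)] could be added; so [X]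
    exhausts [A] or [B] and yields an injection of that side. *)
Lemma card_le_total {T U : Type} (A : set T) (B : set U) :
  A #<= B \/ B #<= A.
Proof.
pose P (X : set (T * U)) :=
  [/\ forall p, X p -> A p.1 /\ B p.2,
      forall p q, X p -> X q -> p.1 = q.1 -> p = q &
      forall p q, X p -> X q -> p.2 = q.2 -> p = q].
have [F FP Ftot|X [[XAB Xfun Xinj] Xmax]] := @Zorn_bigcup _ P.
  have common := total_bigcup2 F Ftot.
  split=> [p [X FX Xp]|p q Fp Fq|p q Fp Fq].
  - by have [+ _ _] := FP _ FX; apply.
  - have [X FX [Xp Xq]] := common _ _ Fp Fq.
    by have [_ + _] := FP _ FX; apply.
  - have [X FX [Xp Xq]] := common _ _ Fp Fq.
    by have [_ _] := FP _ FX; apply.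
have [[a Aa Xa]|Afull] := pselect (exists2 a, A a & forall b, ~ X (a, b)).
  right.
  have Bfull b : B b -> exists a', X (a', b).
    move=> Bb; apply: contrapT => /forallNP Xb.
    apply: (Xmax (X `|` [set (a, b)])).
      split; first by move=> p; left.
      by move=> /(_ (a, b)) => /(_ (or_intror erefl)) /Xa.
    split.
    - by move=> p [/XAB//|->].
    - move=> [x y] [x' y'] [Xp|[-> ->]] [Xq|[-> ->]] //=.
      + exact: Xfun Xp Xq.
      + by move=> xa; move: Xp; rewrite xa => /Xa.
      + by move=> xa; move: Xq; rewrite -xa => /Xa.
    - move=> [x y] [x' y'] [Xp|[-> ->]] [Xq|[-> ->]] //=.
      + exact: Xinj Xp Xq.
      + by move=> yb; move: Xp; rewrite yb => /Xb.
      + by move=> yb; move: Xq; rewrite -yb => /Xb.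
  have /choice[g gX] : forall b, exists a', B b -> X (a', b).
    move=> b; have [/Bfull[a' Xa']|nBb] := pselect (B b); first by exists a'.
    by exists a.
  apply: (card_le_inj _ _ g) => [b /gX/XAB[]//|b b' Bb Bb' gbb'].
  by have [] := Xfun _ _ (gX _ Bb) (gX _ Bb') gbb'.
left.
have {}Afull a : A a -> exists b, X (a, b).
  by move=> Aa; apply: contrapT => /forallNP Xa; apply: Afull; exists a.
(* An empty [U] offers no default value for [g], but then [A] is empty too. *)
have [[u]|nU] := pselect (inhabited U); last first.
  suff -> : A = set0 by exact: card_ge0.
  by rewrite -subset0 => a /Afull[b _]; apply: nU.
have /choice[g gX] : forall a, exists b, A a -> X (a, b).
  move=> a; have [/Afull[b Xb]|nAa] := pselect (A a); first by exists b.
  by exists u.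
apply: (card_le_inj _ _ g) => [b /gX/XAB[]//|b b' Bb Bb' gbb'].
by have [] := Xinj _ _ (gX _ Bb) (gX _ Bb') gbb'.
Qed.

(** * Embedding the square of an infinite set into the set *)

Section Square.
Variable T : Type.

(* [square_graph X]: [X] is the graph of an injection [D * D -> D], where [D] is
   recovered as [dom X]. *)
Let dom (X : set (T * T * T)) : set T := [set x | exists y z, X (x, y, z)].

Let square_graph (X : set (T * T * T)) :=
  [/\ forall x y z, X (x, y, z) -> dom X y /\ dom X z,
      forall x y, dom X x -> dom X y -> exists z, X (x, y, z),
      forall x y z z', X (x, y, z) -> X (x, y, z') -> z = z' &
      forall x y x' y' z, X (x, y, z) -> X (x', y', z) -> x = x' /\ y = y'].

Let square_graph_bigcup (F : set (set (T * T * T))) :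
  F `<=` square_graph -> total_on F subset ->
  square_graph (\bigcup_(X in F) X).
Proof.
move=> FP Ftot.
have common := total_bigcup2 F Ftot.
have domF X x : F X -> dom X x -> dom (\bigcup_(X in F) X) x.
  by move=> FX [y [z Xxyz]]; exists y, z, X.
split.
- move=> x y z [X FX Xp]; have [+ _ _ _] := FP _ FX.
  by move=> /(_ _ _ _ Xp)[? ?]; split; exact: domF FX _.
- move=> x y [x1 [x2 Xx]] [y1 [y2 Xy]].
  have [X FX [Xp Xq]] := common _ _ Xx Xy; have [_ + _ _] := FP _ FX.
  move=> /(_ x y)[||z Xz]; [by exists x1, x2|by exists y1, y2|].
  by exists z, X.
- move=> x y z z' Fp Fq; have [X FX [Xp Xq]] := common _ _ Fp Fq.
  by have [_ _ + _] := FP _ FX; apply; [exact: Xp|exact: Xq].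
- move=> x y x' y' z Fp Fq; have [X FX [Xp Xq]] := common _ _ Fp Fq.
  by have [_ _ _] := FP _ FX; apply; [exact: Xp|exact: Xq].
Qed.

Let square_graph_of (D : set T) (m : T -> T -> T) (d : T) : D d ->
  (forall x y, D x -> D y -> D (m x y)) ->
  (forall x y x' y', D x -> D y -> D x' -> D y' ->
    m x y = m x' y' -> x = x' /\ y = y') ->
  let X := [set p : T * T * T | [/\ D p.1.1, D p.1.2 & p.2 = m p.1.1 p.1.2]] in
  square_graph X /\ dom X = D.
Proof.
move=> Dd mD minj X.
have domX : dom X = D.
  by apply/seteqP; split => [x [y [z []]]//|x Dx]; exists d, (m x d).
split=> //; split; rewrite ?domX.
- by move=> x y z [/= Dx Dy ->]; split => //; exact: mD.
- by move=> x y Dx Dy; exists (m x y).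
- by move=> x y z z' [/= _ _ ->] [/= _ _ ->].
- by move=> x y x' y' z [/= Dx Dy ->] [/= Dx' Dy']; exact: minj.
Qed.

(** Zorn's lemma gives a maximal injection [D * D -> D] extending one on a countable set. If [D]
    embedded in its complement, this injection would extend further; so the complement embeds in
    [D], hence [T] does, and then so does [T * T]. *)
Lemma card_le_square : infinite_set [set: T] -> [set: T * T] #<= [set: T].
Proof.
move=> infT.
have [t0 _] := infinite_setN0 infT.
have /(card_le_ex_inj t0)[e [_ einj]] := (infiniteP [set: T]).1 infT.
have {}einj i j : e i = e j -> i = j by exact: einj.
have /(card_le_ex_inj 0%N)[pr [_ prinj]] : [set: nat * nat] #<= [set: nat].
  by have := card_nat2; rewrite card_eq_le => /andP[].
have {}prinj p q : pr p = pr q -> p = q by exact: prinj.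
have /choice[einv einvK] : forall x, exists i, range e x -> e i = x.
  move=> x; have [[i _ <-]|nx] := pselect (range e x); first by exists i.
  by exists 0%N.
(* The pairing of naturals, carried to [range e], is the starting injection. *)
pose m0 x y := e (pr (einv x, einv y)).
have [|||X0sq X0dom] := @square_graph_of (range e) m0 (e 0%N) _.
- by exists 0%N.
- by move=> x y _ _; exists (pr (einv x, einv y)).
- move=> x y x' y' /einvK ex /einvK ey /einvK ex' /einvK ey' /einj/prinj[].
  by rewrite -{2}ex -{2}ex' -{2}ey -{2}ey' => -> ->.
set X0 := (X in square_graph X) in X0sq X0dom.
(* The empty set must satisfy [P], being the union of the empty chain; any other [X] has to contain
   [X0], so that [D] contains [range e]. *)
pose P X := square_graph X /\ (X !=set0 -> X0 `<=` X).
have [F FP Ftot|X [[Xsq XX0] Xmax]] := @Zorn_bigcup _ P.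
  split; first by apply: square_graph_bigcup Ftot => X /FP[].
  move=> [p [X FX Xp]]; apply: (subset_trans (B := X)).
    by apply: (FP _ FX).2; exists p.
  exact: bigcup_sup.
have {}XX0 : X0 `<=` X.
  have [X0'|/set0P/negP/negPn/eqP X0'] := pselect (X !=set0); first exact: XX0.
  have Xsub : X `<` X0.
    rewrite X0'; split=> // /(_ (e 0%N, e 0%N, m0 (e 0%N) (e 0%N))).
    by apply; split => //=; exists 0%N.
  by exfalso; apply: (Xmax _ Xsub); split => // _.
have [Xcod Xtot Xfun Xinj] := Xsq.
set D := dom X.
have De i : D (e i).
  exists (e 0%N), (m0 (e i) (e 0%N)); apply: XX0.
  by split => //=; [exists i|exists 0%N].
have [m mX] : exists m : T -> T -> T, forall x y, D x -> D y -> X (x, y, m x y).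
  have /choice[m mX] : forall p : T * T, exists z,
      D p.1 -> D p.2 -> X (p.1, p.2, z).
    move=> [x y]; have [[Dx Dy]|nD] := pselect (D x /\ D y).
      by have [z Xz] := Xtot _ _ Dx Dy; exists z.
    by exists t0 => Dx Dy; exfalso; apply: nD.
  by exists (fun x y => m (x, y)) => x y; exact: (mX (x, y)).
have mD x y : D x -> D y -> D (m x y).
  by move=> Dx Dy; have [] := Xcod _ _ _ (mX _ _ Dx Dy).
have minj x y x' y' : D x -> D y -> D x' -> D y' ->
    m x y = m x' y' -> x = x' /\ y = y'.
  move=> Dx Dy Dx' Dy' mm; apply: Xinj (mX _ _ Dx Dy) _.
  by rewrite mm; exact: mX.
have e01 : e 0%N <> e 1%N by move=> /einj.
(* Two distinct elements of [D] mark membership in [D]; with the mark, elements inside and outside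
   [D] can be coded in [D] without confusion. *)
pose tag x := if `[< D x >] then e 0%N else e 1%N.
have tagD x : D (tag x) by rewrite /tag; case: asboolP => _; exact: De.
have [DC|CD] := card_le_total D (~` D).
  have [h [hC hinj]] := card_le_ex_inj t0 _ _ DC.
  pose E := D `|` h @` D.
  have /choice[k kP] : forall x, exists y, E x ->
      D y /\ (if `[< D x >] then x = y else x = h y).
    move=> x; case: asboolP => Dx; first by exists x.
    have [[//|[y Dy <-]]|nEx] := pselect (E x); first by exists y.
    by exists t0.
  have kD x : E x -> D (k x) by move=> /kP[].
  have kinj x y : E x -> E y -> tag x = tag y -> k x = k y -> x = y.
    move=> /kP[_ kx] /kP[_ ky]; move: kx ky; rewrite /tag.
    case: asboolP => Dx; case: asboolP => Dy.
    - by move=> kx ky _ kk; rewrite kx ky kk.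
    - by move=> _ _ /e01.
    - by move=> _ _ /esym/e01.
    - by move=> kx ky _ kk; rewrite kx ky kk.
  pose c x y := m (m (tag x) (tag y)) (m (k x) (k y)).
  have cD x y : E x -> E y -> D (c x y).
    by move=> Ex Ey; apply: (mD); apply: mD => //; exact: kD.
  (* Pairs outside [D * D] go to the image of [D] under [h], which misses [D], so they cannot
     collide with values of [m]. *)
  pose m' x y := if `[< D x /\ D y >] then m x y else h (c x y).
  have [|||Ysq Ydom] := @square_graph_of E m' (e 0%N) _.
  - by left.
  - move=> x y Ex Ey; rewrite /m'; case: asboolP => [[Dx Dy]|_].
      by left; exact: mD.
    by right; exists (c x y) => //; exact: cD.
  - move=> x y x' y' Ex Ey Ex' Ey'; rewrite /m'.
    case: asboolP => [[Dx Dy]|_]; case: asboolP => [[Dx' Dy']|_].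
    + exact: minj.
    + move=> mh; case: (hC (c x' y') (cD _ _ Ex' Ey')).
      by rewrite -mh; exact: mD.
    + by move=> mh; case: (hC (c x y) (cD _ _ Ex Ey)); rewrite mh; exact: mD.
    + move=> /(hinj _ _ (cD _ _ Ex Ey) (cD _ _ Ex' Ey')) /minj[].
      * exact: mD.
      * by apply: mD; exact: kD.
      * exact: mD.
      * by apply: mD; exact: kD.
      * move=> /minj[] // tx ty /minj[]; try exact: kD.
        by move=> kx ky; split; exact: kinj.
  set Y := (Y in square_graph Y) in Ysq Ydom.
  have XY : X `<=` Y.
    move=> [[x y] z] Xp; have Dx : D x by exists y, z.
    have [Dy _] := Xcod _ _ _ Xp.
    split=> /=; [by left|by left|rewrite /m'; case: asboolP => [_|[]//]].
    exact: Xfun Xp (mX _ _ Dx Dy).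
  have XproperY : X `<` Y.
    (* The extension is proper because [h (e 0)] lies in [dom Y] but not in [D]. *)
    split=> // YX; apply: (hC (e 0%N) (De 0%N)).
    have : dom Y (h (e 0%N)) by rewrite Ydom; right; exists (e 0%N).
    by move=> [y [z /YX Xp]]; exists y, z.
  by case: (Xmax _ XproperY); split=> // _; exact: subset_trans XY.
have [h [hD hinj]] := card_le_ex_inj t0 _ _ CD.
pose k x := if `[< D x >] then x else h x.
have kD x : D (k x) by rewrite /k; case: asboolP => // /hD.
pose g x := m (tag x) (k x).
have gD x : D (g x) by exact: mD.
have ginj x y : g x = g y -> x = y.
  move=> /minj[] //; rewrite /tag /k.
  case: asboolP => Dx; case: asboolP => Dy //.
  - by move=> /esym/e01.
  - by move=> _; exact: hinj.
apply: (card_le_inj _ _ (fun p => m (g p.1) (g p.2))) => // -[x y] [x' y'] _ _.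
by move=> /= /minj[] // /ginj -> /ginj ->.
Qed.

End Square.

(** * Well orders and transfinite recursion *)

Lemma well_order_rel (T : Type) : exists lt : T -> T -> Prop,
  well_founded lt /\ forall x y, [\/ lt x y, x = y | lt y x].
Proof.
(* This gives [T] a boolean equality, needed for [[:: x; y]] and [pred1 u] below. *)
elim/Peq: T => T.
have [R Rwo] := well_ordering_principle T.
exists (fun x y => ~~ R y x); split=> [x|x y].
  apply: contrapT => nx.
  have [|z [[/asboolP nz zmin] _]] :=
      Rwo [pred y | `[< ~ Acc (fun x y => ~~ R y x) y >]].
    by exists x; apply/asboolP.
  apply: nz; constructor => y Rzy; apply: contrapT => ny.
  by case/negP: Rzy; apply: zmin; apply/asboolP.
have [Ryx|] := boolP (R y x); last by constructor 1.
have [Rxy|] := boolP (R x y); last by constructor 3.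
constructor 2.
(* When [R x y] and [R y x], both points are minima of the pair, and minima are unique. *)
have [|z [_ zmin]] := Rwo [mem [:: x; y]]; first by exists x; exact: mem_head.
have Rxx u : R u u.
  have [|v [[]]] := Rwo (pred1 u); first by exists u; exact: eqxx.
  by rewrite inE => /eqP -> /(_ u); rewrite inE eqxx => /(_ isT).
rewrite -(zmin x) ?(zmin y)//; (split; first by rewrite !inE eqxx ?orbT).
  by move=> u; rewrite !inE => /orP[]/eqP ->.
by move=> u; rewrite !inE => /orP[]/eqP ->.
Qed.

(** If some initial segment is as large as [T], take the least [t] with such a segment, inject [T]
    into it by [h], and pull the order back along [h]. A large segment below [x] would give one
    below [h x], against the minimality of [t]. *)
Lemma initial_well_order (T : Type) : exists lt : T -> T -> Prop,
  [/\ well_founded lt, forall x y, [\/ lt x y, x = y | lt y x] &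
      forall x, ~ ([set: T] #<= [set y | lt y x])].
Proof.
have [lt [ltwf lttot]] := well_order_rel T.
have [[t tbig]|small] := pselect (exists x, [set: T] #<= [set y | lt y x]);
  last first.
  by exists lt; split=> // x xbig; apply: small; exists x.
have {t tbig} [t tbig tmin] : exists2 t, [set: T] #<= [set y | lt y t] &
    forall x, lt x t -> ~ ([set: T] #<= [set y | lt y x]).
  apply: contrapT => nt; suff: forall x, ~ ([set: T] #<= [set y | lt y x]).
    by move=> /(_ t).
  by apply: (well_founded_ind ltwf) => x IH xbig; apply: nt; exists x.
have [h [hlt hinj]] := card_le_ex_inj t _ _ tbig.
exists (fun x y => lt (h x) (h y)); split.
- move=> x; move: {-1}(h x) (erefl (h x)) => u.
  elim/(well_founded_ind ltwf): u x => u IH x hx.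
  by constructor=> y yx; apply: (IH (h y)) => //; rewrite -hx.
- move=> x y; have [?|hxy|?] := lttot (h x) (h y); first by constructor 1.
    by constructor 2; exact: hinj.
  by constructor 3.
- move=> x xbig; apply: tmin (hlt x I) _.
  apply: card_le_trans xbig _; apply: (card_le_inj _ _ h) => // y z _ _.
  exact: hinj.
Qed.

(** The step function sees only the set of earlier values, which is all that a choice compatible
    with them requires. *)
Lemma transfinite_recursion (T V : Type) (lt : T -> T -> Prop) :
  well_founded lt -> forall c : T -> set V -> V,
  exists f : T -> V, forall t, f t = c t (f @` [set s | lt s t]).
Proof.
move=> ltwf c.
pose F t (rec : forall s, lt s t -> V) :=
  c t [set v | exists s (st : lt s t), rec s st = v].
exists (Fix ltwf (fun=> V) F) => t.
rewrite Fix_eq => [|x f g fg]; last first.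
  by rewrite (_ : f = g)//; apply: functional_extensionality_dep => s;
    apply: funext.
rewrite {1}/F; congr (c t _); apply/seteqP; split => v.
  by move=> [s [st <-]]; exists s.
by move=> [s st <-]; exists s, st.
Qed.

(** * Arithmetic of sets smaller than [T] *)

Section Small.
Variables (T : Type) (infT : infinite_set [set: T]).

(* Of cardinality less than that of [T], by [card_le_total]. *)
Definition small {X : Type} (A : set X) := ~ ([set: T] #<= A).

Lemma small_le (X Y : Type) (A : set X) (B : set Y) :
  A #<= B -> small B -> small A.
Proof. by move=> AB Bs As; apply: Bs; exact: card_le_trans AB. Qed.

(** The product embeds in the square of the larger factor. The square of a finite set is finite, and
    that of an infinite set embeds in the set. *)
Lemma small_setX (X Y : Type) (A : set X) (B : set Y) :
  small A -> small B -> small (A `*` B).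
Proof.
have sq (Z : Type) (C : set Z) : small C -> small (C `*` C).
  move=> Cs CCbig; have [Cfin|Cinf] := pselect (finite_set C).
    by apply: infT; apply: card_le_finite CCbig _; exact: finite_setX.
  apply: Cs; apply: card_le_trans CCbig _.
  have [z0 Cz0] := infinite_setN0 Cinf.
  have := card_setT C; rewrite card_eq_le => /andP[CT TC].
  have /card_le_square : infinite_set [set: C].
    by move=> Cfin; apply: Cinf; exact: card_le_finite TC Cfin.
  move=> /card_le_trans -/(_ _ _ CT); apply: card_le_trans.
  have c0 : C := SigSub (mem_set Cz0).
  have [j [_ jinj]] := card_le_ex_inj c0 _ _ TC.
  apply: (card_le_inj _ _ (fun p => (j p.1, j p.2))) => //.
  by move=> [x y] [x' y'] [/= ? ?] [/= ? ?] [/jinj -> // /jinj -> //].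
move=> As Bs.
have [[[x y] [/= Ax By]]|AB0] := pselect (A `*` B !=set0); last first.
  have -> : A `*` B = set0.
    by rewrite -subset0 => p ABp; apply: AB0; exists p.
  by apply: small_le As; exact: card_ge0.
have [/(card_le_ex_inj y)|/(card_le_ex_inj x)] := card_le_total A B;
    move=> [j [jD jinj]].
- apply: small_le (sq _ _ Bs).
  apply: (card_le_inj _ _ (fun p => (j p.1, p.2))) => [[u v] [/= Au Bv]|].
    by split => //; exact: jD.
  by move=> [u v] [u' v'] [/= ? ?] [/= ? ?] [/jinj -> // ->].
- apply: small_le (sq _ _ As).
  apply: (card_le_inj _ _ (fun p => (p.1, j p.2))) => [[u v] [/= Au Bv]|].
    by split => //; exact: jD.
  by move=> [u v] [u' v'] [/= ? ?] [/= ? ?] [-> /jinj -> //].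
Qed.

(** Sending [x] to a chosen index [k x] and to its image under an injection of [F (k x)] into [B]
    embeds the union in [D * B]. *)
Lemma small_bigcup (I X Y : Type) (D : set I) (F : I -> set X) (B : set Y) :
  small D -> small B -> (forall i, D i -> F i #<= B) ->
  small (\bigcup_(i in D) F i).
Proof.
move=> Ds Bs FB.
have [[y]|nY] := pselect (inhabited Y); last first.
  apply: small_le Bs.
  suff -> : \bigcup_(i in D) F i = set0 by exact: card_ge0.
  rewrite -subset0 => x [i Di Fx].
  have /card_leP[g] := FB _ Di.
  by apply: nY; constructor; exact: (val (g (SigSub (mem_set Fx)))).
have [[i0]|nI] := pselect (inhabited I); last first.
  apply: small_le Ds.
  suff -> : \bigcup_(i in D) F i = set0 by exact: card_ge0.
  by rewrite -subset0 => x [i]; exfalso; apply: nI.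
have /choice[g gP] : forall i, exists g : X -> Y, D i ->
    (forall x, F i x -> B (g x)) /\
    (forall x x', F i x -> F i x' -> g x = g x' -> x = x').
  move=> i; have [Di|nDi] := pselect (D i); last by exists (fun=> y).
  by have [g gP] := card_le_ex_inj y _ _ (FB _ Di); exists g.
have /choice[k kP] : forall x, exists i, (\bigcup_(i in D) F i) x ->
    D i /\ F i x.
  move=> x; have [[i Di Fx]|nx] := pselect ((\bigcup_(i in D) F i) x).
    by exists i.
  by exists i0.
apply: small_le (small_setX _ _ _ _ Ds Bs).
apply: (card_le_inj _ _ (fun x => (k x, g (k x) x))) => [x /kP[Dk Fk]|].
  by split => //=; apply: (gP _ Dk).1.
move=> x x' /kP[Dk Fk] /kP[Dk' Fk'] [kk].
by rewrite kk; apply: (gP _ Dk').2 => //; rewrite -kk.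
Qed.

Lemma small_image (X Y : Type) (f : X -> Y) (A : set X) :
  small A -> small (f @` A).
Proof. exact/small_le/card_image_le. Qed.

Lemma nsmall_setT : ~ small [set: T].
Proof. by apply; exact: card_lexx. Qed.

End Small.

(** * Building the resolution classes *)

Section Resolution.
Variables (T : Type) (infT : infinite_set [set: T]).
Variables (G : set (graph T)) (decG : decomposition (complete_graph T) G).
Variables (U : Type) (Usmall : small T [set: U]).
Hypothesis R1 : forall H : graph T, G H -> bounded_by [set: U] H.
Hypothesis R2 : forall x y : T, x <> y ->
  graphs_at G x `&` graphs_at G y #<= [set: U].

Lemma exists_neq (x : T) : exists y, x <> y.
Proof.
apply: contrapT => /forallNP xT; apply: infT.
apply: sub_finite_set (finite_set1 x) => y _ /=.
by apply: esym; apply: contrapT; exact: xT.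
Qed.

Lemma edge_graph (x y : T) : x <> y ->
  exists2 H, G H & edges H [set x; y].
Proof.
move=> xy; have [_ [+ _ _]] := decG.
have exy : edges (complete_graph T) [set x; y] by exists x, y.
by move=> covG; move: exy; rewrite -covG.
Qed.

Lemma edge_vertices (H : graph T) (x y : T) :
  edges H [set x; y] -> vertices H x /\ vertices H y.
Proof.
move=> /edges_pairs[u [v [Hu Hv _ xyuv]]].
have inH z : [set x; y] z -> vertices H z by rewrite xyuv => -[] ->.
by split; apply: inH; [left|right].
Qed.

Lemma graph_edge (H : graph T) : G H ->
  exists x y, x <> y /\ edges H [set x; y].
Proof.
move=> GH; have [_ [_ _ /(_ _ GH)[e He]]] := decG.
have [x [y [_ _ xy exy]]] := edges_pairs He.
by exists x, y; rewrite -exy.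
Qed.

Lemma edge_graph_uniq (H K : graph T) (e : set T) :
  G H -> G K -> edges H e -> edges K e -> H = K.
Proof.
move=> GH GK He Ke; have [_ [_ + _]] := decG.
by apply => //; exists e.
Qed.

(* A pair [(H, i)] records that [H] is put in the class of index [i]. *)
Definition compat (p q : graph T * T) :=
  (p.1 = q.1 -> p.2 = q.2) /\
  (p.2 = q.2 -> vertices p.1 `&` vertices q.1 !=set0 -> p.1 = q.1).

Lemma compat_sym p q : compat p q -> compat q p.
Proof.
by move=> [pq1 pq2]; split=> [/esym/pq1//|/esym/pq2 pq]; rewrite setIC => /pq.
Qed.

(* The graphs at [v] that meet an assigned graph outside [v] form a small
   family, whereas the graphs at [v] cover [T] by small sets. *)
Lemma fresh_graph (A : set (graph T)) (v : T) : small T A -> A `<=` G ->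
  exists H, [/\ G H, vertices H v, ~ A H &
    forall K x, A K -> vertices H x -> vertices K x -> x = v].
Proof.
move=> As AG; apply: contrapT => nofresh.
pose W := (\bigcup_(K in A) vertices K) `\ v.
pose B := \bigcup_(w in W) (graphs_at G v `&` graphs_at G w).
have Ws : small T W.
  apply: small_le (card_le_setD _ _) _.
  by apply: small_bigcup As Usmall _ => // K /AG; exact: R1.
have Bs : small T B.
  by apply: small_bigcup Ws Usmall _ => // w [_ /= wv]; apply: R2 => /esym.
have GB H : G H -> vertices H v -> B H.
  move=> GH Hv; apply: contrapT => nBH; apply: nofresh; exists H.
  have meet K x : A K -> vertices H x -> vertices K x -> x = v.
    move=> AK Hx Kx; apply: contrapT => xv; apply: nBH.
    by exists x; split => //; exists K.
  (* If [H] were in [A], then [meet] with [K := H] would put both ends of an edge of [H] at [v]. *)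
  split=> // AH; have [x [y [xy /edge_vertices[Hx Hy]]]] := graph_edge _ GH.
  by apply: xy; rewrite (meet H x)// (meet H y).
apply: (nsmall_setT T).
suff -> : [set: T] = \bigcup_(H in B) vertices H.
  apply: small_bigcup Bs Usmall _ => // H [w _ [[GH _] _]]; exact: R1.
apply/seteqP; split => // x _.
have [y vy] := exists_neq v.
have [y' vy' xy'] : exists2 y', v <> y' & x = v \/ x = y'.
  have [->|vx] := pselect (x = v); first by exists y => //; left.
  by exists x; [move=> /esym|right].
have [H GH /edge_vertices[Hv Hy']] := edge_graph _ _ vy'.
by exists H; [exact: GB|case: xy' => ->].
Qed.

(* [(false, v, i)]: the class of index [i] covers [v];
   [(true, x, y)]: the graph containing the edge [xy] lies in some class. *)
Definition task (t : bool * T * T) (p : graph T * T) :=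
  if t.1.1 then t.1.2 <> t.2 -> edges p.1 [set t.1.2; t.2]
  else vertices p.1 t.1.2 /\ p.2 = t.2.

Definition extends (t : bool * T * T) (A : set (graph T * T)) p :=
  [/\ G p.1, task t p & forall q, A q -> compat p q].

Lemma exists_extends (t : bool * T * T) (A : set (graph T * T)) :
  small T A -> (forall p, A p -> G p.1) ->
  (forall p q, A p -> A q -> compat p q) -> exists p, extends t A p.
Proof.
move=> As AG Acompat.
have cover_ext v i : exists p, extends (false, v, i) A p.
  (* If class [i] already covers [v], its pair is repeated. Otherwise a fresh graph meets assigned
     graphs only in [v], and none of those through [v] has index [i]. *)
  have [[p [Ap pv pi]]|nocov] :=
      pselect (exists p, [/\ A p, vertices p.1 v & p.2 = i]).
    by exists p; split=> [||q Aq]; [exact: AG| |exact: Acompat].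
  have [|H [GH Hv nAH Hmeet]] := fresh_graph _ v (small_image T _ _ fst A As).
    by move=> _ [p Ap <-]; exact: AG.
  exists (H, i); split=> // q Aq; split=> /= [Hq|iq [x [Hx qx]]].
    by case: nAH; exists q.
  have xv := Hmeet q.1 x (imageP fst Aq) Hx qx.
  by case: nocov; exists q; rewrite -xv.
case: t => [[[] x] y]; last exact: cover_ext.
(* For [x = y] the task demands nothing, and any compatible pair will do. *)
have [xy|xy] := pselect (x = y).
  have [p [Gp _ pA]] := cover_ext x x.
  by exists p; split => // /(_ xy).
have [H GH Hxy] := edge_graph _ _ xy.
have [[p Ap pH]|nAH] := pselect (exists2 p, A p & p.1 = H).
  exists p; split=> [||q Aq]; [exact: AG| |exact: Acompat].
  by rewrite /task /= pH.
have [i nAi] : exists i, ~ (snd @` A) i.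
  apply: contrapT => /forallNP Ai; apply: (nsmall_setT T).
  suff -> : [set: T] = snd @` A by exact: small_image As.
  by apply/seteqP; split => // i _; apply: contrapT; exact: Ai.
exists (H, i); split=> // q Aq; split=> /= [Hq|iq].
  by case: nAH; exists q.
by case: nAi; exists q.
Qed.

(** Two uses of the embedding [p] of [T * T] in [T], with booleans coded by two distinct points,
    inject the tasks into [T]; [h] is a left inverse. *)
Lemma task_surjection :
  exists h : T -> bool * T * T, forall t, exists s, h s = t.
Proof.
have [t0 _] := infinite_setN0 infT.
have sq := card_le_square T infT.
have [p [_ pinj]] := card_le_ex_inj t0 _ _ sq.
have [t1 t01] := exists_neq t0.
pose b2T (b : bool) := if b then t1 else t0.
have b2T_inj b b' : b2T b = b2T b' -> b = b'.
  by case: b; case: b' => //= /esym.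
pose j (t : bool * T * T) := p (p (b2T t.1.1, t.1.2), t.2).
have jinj s t : j s = j t -> s = t.
  move: s t => [[b x] y] [[b' x'] y'] /(pinj _ _ I I)[].
  by move=> /(pinj _ _ I I)[/b2T_inj -> -> ->].
have /choice[h hP] : forall s, exists t, (exists t', j t' = s) -> j t = s.
  move=> s; have [[t <-]|ns] := pselect (exists t, j t = s); first by exists t.
  by exists (false, t0, t0).
by exists h => t; exists (j t); apply: jinj; apply: hP; exists t.
Qed.

Lemma exists_assignment : exists f : T -> graph T * T,
  [/\ forall t, G (f t).1, forall s t, compat (f s) (f t) &
      forall k, exists t, task k (f t)].
Proof.
have [lt [ltwf lttot ltsmall]] := initial_well_order T.
have [h hsurj] := task_surjection.
have [t0 _] := infinite_setN0 infT.
(* [c] picks an extension whenever one exists; [(complete_graph T, t0)] is a default. *)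
have /choice[c cP] : forall k : T * set (graph T * T), exists p,
    (exists p, extends (h k.1) k.2 p) -> extends (h k.1) k.2 p.
  move=> k; have [[p kp]|nk] := pselect (exists p, extends (h k.1) k.2 p).
    by exists p.
  by exists (complete_graph T, t0).
have [f fE] := transfinite_recursion _ _ _ ltwf (fun t A => c (t, A)).
have fP t : extends (h t) (f @` [set s | lt s t]) (f t).
  elim/(well_founded_ind ltwf): t => t IH.
  rewrite [X in extends _ _ X]fE; apply: (cP (t, _)); apply: exists_extends.
  - by apply: small_image; exact: ltsmall.
  - by move=> _ [s /= /IH[Gs _ _] <-].
  - move=> _ _ [s /= st <-] [s' /= s't <-].
    (* Of two earlier values, the later one was chosen compatible with the other. *)
    have [ss'|->|s's] := lttot s s'.
    + by apply: compat_sym; have [_ _] := IH _ s't; apply; exists s.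
    + by split.
    + by have [_ _] := IH _ st; apply; exists s'.
exists f; split=> [t|s t|k].
- by have [] := fP t.
- have [st|->|ts] := lttot s t.
  + by apply: compat_sym; have [_ _] := fP t; apply; exists s.
  + by split.
  + by have [_ _] := fP s; apply; exists t.
- by have [t <-] := hsurj k; exists t; have [] := fP t.
Qed.

(** The first clause of [compat] makes distinct classes disjoint, the second makes the graphs of one
    class vertex-disjoint. Tasks [(false, v, i)] make each class spanning; tasks [(true, x, y)]
    place every graph, since each has an edge and is determined by it. *)
Lemma decomposition_resolvable : resolvable (complete_graph T) G.
Proof.
have [f [fG fcompat ftask]] := exists_assignment.
pose class i : set (graph T) := [set H | exists t, f t = (H, i)].
have classG i : class i `<=` G by move=> H [t ft]; have := fG t; rewrite ft.
have class_cover i v : exists2 H, class i H & vertices H v.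
  have [t [/= fv fi]] := ftask (false, v, i).
  by exists (f t).1 => //; exists t; rewrite -fi; case: (f t).
exists (range class); split; last first.
  move=> _ [i _ <-]; split=> //.
    move=> H K [s fs] [t ft] HK; have [_] := fcompat s t.
    by rewrite fs ft; apply.
  by apply/seteqP; split => // v _; have [H] := class_cover i v; exists H.
split.
- apply/seteqP; split => [H [_ [i _ <-]] /classG//|H GH].
  have [x [y [xy Hxy]]] := graph_edge _ GH.
  have [t /(_ xy) /= ft] := ftask (true, x, y).
  exists (class (f t).2) => //; exists t.
  by rewrite (edge_graph_uniq _ _ _ GH (fG t) Hxy ft); case: (f t).
- move=> _ _ [i _ <-] [j _ <-] [H [[s fs] [t ft]]].
  by have [+ _] := fcompat s t; rewrite fs ft => /(_ erefl) /= ->.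
- move=> _ [i _ <-]; have [t0 _] := infinite_setN0 infT.
  by have [H] := class_cover i t0; exists H.
Qed.

End Resolution.

Theorem theorem5p4 (T : Type) (infT : infinite_set [set: T])
  (G : set (graph T)) (decG : decomposition (complete_graph T) G)
  (U : Type) (ltUT : card_lt [set: U] [set: T])
  (R1 : forall H : graph T, G H -> bounded_by [set: U] H)
  (R2 : forall x y : T, x <> y ->
    graphs_at G x `&` graphs_at G y #<= [set: U]) :
  resolvable (complete_graph T) G.
Proof.
by have [_ Usmall] := ltUT; apply: decomposition_resolvable Usmall R1 R2.
Qed.
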